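(* Let $d\ge3$, let $K_\bullet$ be time-homogeneous, suppose the assumptions (E1), (E2), (E3) listed in the context hold, and suppose that $\eta^{N,N}_0=\eta_0^{\otimes N}$, where $\eta^{N,N}_0=\mathrm{Law}(X^1_0,\dots,X^N_0)$. Then there are $\kappa\in(0,1/d)$ and $C'$ independent of $n,N$ such that for all $n\ge0$ and $N\ge1$ $$\mathbf E[\mathbf W_1(\eta^N_n,\eta_n)]\le\frac{C'}{N^\kappa}.$$
   Context: $\mathcal P(\mathbb R^d)$ is the set of Borel probability measures on $\mathbb R^d$; $\mathcal P_1$ denotes those with finite first moment; $\mathbf W_1$ is the 1-Wasserstein distance for the Euclidean norm; $\mu K(dy)=\int\mu(dx)K(x,dy)$; $m(\bar x)=\frac1N\sum_{i=1}^N\delta_{x^i}$ for $\bar x=(x^1,\dots,x^N)$. $K_\bullet=\{K_\eta:\eta\in\mathcal P(\mathbb R^d)\}$ is a family of Markov kernels on $\mathbb R^d$. Standing assumption: for each $\eta\in\mathcal P_1(\mathbb R^d)$ there are $C_0,C_1,R\ge0$ with $\int\|y\|K_\eta(x,dy)\le C_0+C_1\|x\|$ for all $\|x\|>R$; it is understood that this ensures $\mu K_\eta\in\mathcal P_1(\mathbb R^d)$ whenever $\mu,\eta\in\mathcal P_1(\mathbb R^d)$. Mean-field dynamics: given $\eta_0$, $\eta_{n+1}=\eta_nK_{\eta_n}$. Particle dynamics: $X^1_0,\dots,X^N_0$ are i.i.d. with law $\eta_0$; given the particles up to time $n$, the variables $X^1_{n+1},\dots,X^N_{n+1}$ are conditionally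 independent with $X^i_{n+1}\sim K_{\eta^N_n}(X^i_n,\cdot)$, where $\bar X^N_n=(X^1_n,\dots,X^N_n)$ and $\eta^N_n=m(\bar X^N_n)$. Assumptions (with $p>1$, $p\neq d/(d-1)$). (E1) There is a finite best constant $\tau:=\tau_1(K_\bullet)$ with $\mathbf W_1(\mu K_\mu,\nu K_\nu)\le\tau\,\mathbf W_1(\mu,\nu)$ for all $\mu,\nu\in\mathcal P_1(\mathbb R^d)$, and $\tau>1$; moreover $\mathbf E[\|X^1_k\|^p]\le M^{(p)}_k\le M^{(p)}_\star<\infty$ for all $k$; so that $\mathbf E[\mathbf W_1(\eta^N_n,\eta_n)]\le\tilde C_{p,d}\,N^{-1/d}\tau^n$ for some $\tilde C_{p,d}>0$ independent of $N$. (E2) There are $\alpha<1$, $C<\infty$, an invariant measure $\eta_\infty\in\mathcal P_1(\mathbb R^d)$ for the mean-field dynamics and, for every $N\ge1$, an invariant measure $\eta^{N,N}_\infty\in\mathcal P_1((\mathbb R^d)^{\otimes N})$ for the $N$-particle dynamics such that $$\mathbf W_1(\eta_n,\eta_\infty)\le C\alpha^n\,\mathbf W_1(\eta_0,\eta_\infty),\qquad \mathbf E[\mathbf W_1(\eta^N_n,\eta^N_\infty)]\le C\alpha^n\,\mathbf E[\mathbf W_1(\eta^N_0,\eta^N_\infty)],$$ where $\eta^N_\infty:=m(\bar X^N_\infty)$ with $\bar X^N_\infty\sim\eta^{N,N}_\infty$. (E3) $\eta_\infty$ has finite $p$-th moment for some $p>1$. *)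

(* Defs.v *)
From HB Require Import structures.
From mathcomp Require Import all_boot all_order all_algebra.
From mathcomp Require Import all_classical all_reals all_analysis.
From mathcomp Require Import measurable_realfun giry random_variable.

Set Implicit Arguments.
Unset Strict Implicit.
Unset Printing Implicit Defensive.
Import Order.TTheory GRing.Theory Num.Theory.
Import numFieldNormedType.Exports.

Local Open Scope classical_set_scope.
Local Open Scope ring_scope.
Local Open Scope ereal_scope.

(* R^d is [d.-tuple R] and (R^d)^N is [N.-tuple (d.-tuple R)]. The measurable
   sets of [n.-tuple T] form the product sigma-algebra, which on [d.-tuple R]
   is the Borel sigma-algebra of R^d. Measures are functions on all subsets, so
   two measures are identified when they agree on measurable sets ([≡μ]). *)

Section mu_K.
Context d1 d2 (T1 : measurableType d1) (T2 : measurableType d2) (R : realType).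
Context (mu : probability T1 R) (K : R.-pker T1 ~> T2).

Definition mulK (A : set T2) : \bar R := \int[mu]_x K x A.

Let mulK0 : mulK set0 = 0.
Proof. by apply: integral0_eq => x _; rewrite measure0. Qed.

Let mulK_ge0 A : 0 <= mulK A.
Proof. by apply: integral_ge0 => x _; exact: measure_ge0. Qed.

Let mulK_sigma_additive : semi_sigma_additive mulK.
Proof.
move=> F mF tF mUF; rewrite /mulK.
rewrite [X in _ --> X](_ : _ = \int[mu]_x \sum_(0 <= i <oo) K x (F i)); last first.
  by apply: eq_integral => x _; apply/esym/cvg_lim => //; exact: measure_semi_sigma_additive.
rewrite integral_nneseries//; last by move=> n; exact: measurable_kernel.
apply: is_cvg_nneseries => n _ _.
by apply: integral_ge0 => x _; exact: measure_ge0.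
Qed.

HB.instance Definition _ := isMeasure.Build _ _ _ mulK
  mulK0 mulK_ge0 mulK_sigma_additive.

Let mulKT : mulK [set: T2] = 1.
Proof.
rewrite /mulK (eq_integral (cst 1)); last by move=> x _; rewrite prob_kernel.
by rewrite integral_cst// mul1e; exact: probability_setT.
Qed.

HB.instance Definition _ := Measure_isProbability.Build _ _ _ mulK mulKT.

End mu_K.

(* m(x) = N^-1 \sum_i \d_(x_i); the number N >= 1 of points is written N.+1. *)
Section empirical.
Context d0 (T : measurableType d0) (R : realType) (N : nat).
Context (x : N.+1.-tuple T).

Definition empirical (A : set T) : \bar R :=
  (N.+1%:R^-1)%:E * \sum_(i < N.+1) \d_(tnth x i) A.

Let empirical0 : empirical set0 = 0.
Proof. by rewrite /empirical big1 ?mule0// => i _; rewrite measure0. Qed.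

Let empirical_ge0 A : 0 <= empirical A.
Proof. by apply: mule_ge0; [rewrite lee_fin invr_ge0 | exact: sume_ge0]. Qed.

Let empirical_sigma_additive : semi_sigma_additive empirical.
Proof.
move=> F mF tF mUF; rewrite /empirical.
rewrite [X in X @ _](_ : _ = fun n => (N.+1%:R^-1)%:E *
    \sum_(j < N.+1) \sum_(0 <= i < n) (\d_(tnth x j) (F i) : \bar R)); last first.
  apply/funext => n; rewrite -ge0_sume_distrr; first by rewrite exchange_big.
  by move=> i _; exact: sume_ge0.
apply: cvgeZl => //; apply: cvg_nnesum => j _.
  by near=> n; exact: sume_ge0.
exact: measure_semi_sigma_additive.
Unshelve. all: by end_near. Qed.

HB.instance Definition _ := isMeasure.Build _ _ _ empirical
  empirical0 empirical_ge0 empirical_sigma_additive.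

Let empiricalT : empirical [set: T] = 1.
Proof.
rewrite /empirical (eq_bigr (fun=> 1)); last by move=> i _; rewrite diracT.
by rewrite sumEFin sumr_const card_ord -EFinM mulVf.
Qed.

HB.instance Definition _ := Measure_isProbability.Build _ _ _ empirical empiricalT.

End empirical.

Section euclidean.
Context (R : realType) (d : nat).
Implicit Types x y : d.-tuple R.

Definition enorm x : R := Num.sqrt (\sum_(i < d) tnth x i ^+ 2)%R.

Definition edist x y : R := Num.sqrt (\sum_(i < d) (tnth x i - tnth y i) ^+ 2)%R.

(* the Euclidean norm of (R^d)^N seen as R^(dN) *)
Definition enormN (N : nat) (x : N.-tuple (d.-tuple R)) : R :=
  Num.sqrt (\sum_(i < N) enorm (tnth x i) ^+ 2)%R.

End euclidean.

Section wasserstein.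
Context (R : realType) (d : nat).
Local Notation Rd := (d.-tuple R).
Implicit Types mu nu : probability Rd R.

Definition P1 mu := \int[mu]_x (enorm x)%:E < +oo.

Definition P1N (N : nat) (mu : probability (N.-tuple Rd) R) :=
  \int[mu]_x (enormN x)%:E < +oo.

Definition couplings mu nu : set (probability (Rd * Rd)%type R) :=
  [set pi | forall A, measurable A ->
    pi (A `*` [set: Rd]) = mu A /\ pi ([set: Rd] `*` A) = nu A].

Definition W1 mu nu : \bar R :=
  ereal_inf [set \int[pi]_z (edist z.1 z.2)%:E | pi in couplings mu nu].

End wasserstein.

Section probability_notions.

Definition box (T : Type) (N : nat) (A : 'I_N -> set T) : set (N.-tuple T) :=
  [set x | forall i, A i (tnth x i)].

(* Q is the N-fold product of mu *)
Definition is_power d0 (T : measurableType d0) (R : realType) (N : nat)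
    (mu : probability T R) (Q : probability (N.-tuple T) R) :=
  forall A : 'I_N -> set T, (forall i, measurable (A i)) ->
    Q (box A) = \prod_(i < N) mu (A i).

Definition history d1 d2 (W : measurableType d1) (S : measurableType d2)
    (X : nat -> W -> S) (n : nat) : set (set W) :=
  <<s [set E | exists k B, [/\ (k <= n)%N, measurable B & E = X k @^-1` B]] >>.

(* f is a version of the conditional probability P(E | F) *)
Definition is_cond_prob d1 (W : measurableType d1) (R : realType)
    (P : probability W R) (F : set (set W)) (E : set W) (f : W -> \bar R) :=
  (forall C : set (\bar R), measurable C -> F (f @^-1` C)) /\
  (forall G, F G -> P (G `&` E) = \int[P]_(w in G) f w).

End probability_notions.

Section dynamics.
Context (R : realType) (d : nat).
Local Notation Rd := (d.-tuple R).
Local Notation prob := (probability Rd R).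
Implicit Types K : prob -> R.-pker Rd ~> Rd.

(* K is well defined on Borel probability measures (i.e. modulo [≡μ]), and the
   particle transition probabilities are measurable in the configuration. *)
Definition kernel_family K :=
  (forall eta eta' : prob, eta ≡μ eta' -> forall x, K eta x ≡μ K eta' x) /\
  (forall (N : nat) (i : 'I_N.+1) (A : set Rd), measurable A ->
    measurable_fun [set: N.+1.-tuple Rd]
      (fun x => K (empirical R x) (tnth x i) A)).

Definition standing_assumption K :=
  (forall eta : prob, P1 eta -> exists C0 C1 r : R,
    [/\ (0 <= C0)%R, (0 <= C1)%R, (0 <= r)%R &
      forall x, (r < enorm x)%R ->
        \int[K eta x]_y (enorm y)%:E <= (C0 + C1 * enorm x)%:E]) /\
  (forall mu eta : prob, P1 mu -> P1 eta -> P1 (mulK mu (K eta))).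

Fixpoint mean_field K (eta0 : prob) (n : nat) : prob :=
  if n is n'.+1 then mulK (mean_field K eta0 n') (K (mean_field K eta0 n'))
  else eta0.

(* Conditional independence of the next particles given the configuration x: the
   probability of a box is the product of the K_{m(x)}(x^i, A_i). *)
Definition box_transition K (N : nat) (x : N.+1.-tuple Rd)
    (A : 'I_N.+1 -> set Rd) : \bar R :=
  \prod_(i < N.+1) K (empirical R x) (tnth x i) (A i).

Definition particle_dynamics K (N : nat) d0 (W : measurableType d0)
    (P : probability W R) (X : nat -> {RV P >-> N.+1.-tuple Rd}) :=
  forall (n : nat) (A : 'I_N.+1 -> set Rd), (forall i, measurable (A i)) ->
    is_cond_prob P (history X n) (X n.+1 @^-1` box A)
      (fun w => box_transition K (X n w) A).

Definition mean_field_invariant K (eta : prob) := mulK eta (K eta) ≡μ eta.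

(* boxes generate the sigma-algebra of (R^d)^N and are stable by intersection *)
Definition particle_invariant K (N : nat)
    (mu : probability (N.+1.-tuple Rd) R) :=
  forall A : 'I_N.+1 -> set Rd, (forall i, measurable (A i)) ->
    \int[mu]_x box_transition K x A = mu (box A).

Definition lipschitz_constant K (t : R) :=
  forall mu nu : prob, P1 mu -> P1 nu ->
    W1 (mulK mu (K mu)) (mulK nu (K nu)) <= t%:E * W1 mu nu.

(* tau = tau_1(K) *)
Definition best_constant K (tau : R) :=
  lipschitz_constant K tau /\ (forall t, lipschitz_constant K t -> (tau <= t)%R).

(* In the following, X N is the system of N.+1 particles. *)
Definition E1 K (eta0 : prob) (d0 : nat -> measure_display)
    (W : forall N, measurableType (d0 N)) (P : forall N, probability (W N) R)
    (X : forall N, nat -> {RV (P N) >-> N.+1.-tuple Rd}) (p : R) :=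
  exists tau : R,
  [/\ best_constant K tau,
      (1 < tau)%R,
      (exists (M : nat -> R) (Mstar : R), forall N k,
        \int[P N]_w ((enorm (tnth (X N k w) ord0)) `^ p)%:E <= (M k)%:E /\
        (M k <= Mstar)%R) &
      (exists2 C : R, (0 < C)%R & forall N n,
        \int[P N]_w W1 (empirical R (X N n w)) (mean_field K eta0 n)
          <= (C * N.+1%:R `^ (- d%:R^-1) * tau ^+ n)%:E)].

(* The joint law of the particles at time n and of a vector with the invariant
   law is not prescribed and may depend on n: Xinf n is the invariant vector
   used at time n. A single vector is the case where Xinf is constant. *)
Definition E2 K (eta0 eta_inf : prob) (d0 : nat -> measure_display)
    (W : forall N, measurableType (d0 N)) (P : forall N, probability (W N) R)
    (X : forall N, nat -> {RV (P N) >-> N.+1.-tuple Rd}) :=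
  exists alpha C : R,
  [/\ (alpha < 1)%R,
      P1 eta_inf /\ mean_field_invariant K eta_inf,
      (forall n, W1 (mean_field K eta0 n) eta_inf
                   <= (C * alpha ^+ n)%:E * W1 eta0 eta_inf) &
      forall N, exists etaN_inf : probability (N.+1.-tuple Rd) R,
        [/\ P1N etaN_inf,
            particle_invariant K etaN_inf &
            exists Xinf : nat -> {RV (P N) >-> N.+1.-tuple Rd},
              (forall n, distribution (P N) (Xinf n) ≡μ etaN_inf) /\
              (forall n,
                \int[P N]_w W1 (empirical R (X N n w)) (empirical R (Xinf n w))
                <= (C * alpha ^+ n)%:E *
                   \int[P N]_w W1 (empirical R (X N 0%N w))
                                  (empirical R (Xinf 0%N w)))]].

Definition E3 (eta_inf : prob) :=
  exists2 q : R, (1 < q)%R & \int[eta_inf]_x ((enorm x) `^ q)%:E < +oo.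

End dynamics.

(* Main.v *)
Require Import Defs.
From HB Require Import structures.
From mathcomp Require Import all_boot all_order all_algebra.
From mathcomp Require Import all_classical all_reals all_analysis.
From mathcomp Require Import measurable_realfun giry random_variable.
From mathcomp Require Import ring lra.

(** Write E_n for E W1(eta^N_n, eta_n), T_n for E W1(eta^N_n, eta^N_infty) and
    D_n for E W1(eta^N_infty, eta_n), where D_n only depends on the law of
    eta^N_infty. For n <= m, (E1) at time m bounds E_n. For n >= m, passing
    from eta^N_n to eta_n through eta^N_infty, then eta_m (D_m <= T_m + E_m),
    gives E_n <= T_n + T_m + E_m + W1(eta_m, eta_n), where all terms but E_m are
    O(alpha^m) by (E2). Taking m proportional to ln N balances tau^m N^(-1/d)
    against alpha^m. The gap T_0 is bounded uniformly in N by the same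
    inequalities at a fixed time m with C alpha^m <= 1/2: they read
    T_0 <= const + T_0 / 2, and T_0 is finite.

    The triangle inequality for W1 needs no disintegration: two couplings are
    glued by making them conditionally independent given the cell containing
    the middle point, for a countable partition into cells of diameter <= e. *)

Set Implicit Arguments.
Unset Strict Implicit.
Unset Printing Implicit Defensive.
Import Order.TTheory GRing.Theory Num.Theory.
Import numFieldNormedType.Exports.

Local Open Scope classical_set_scope.
Local Open Scope ring_scope.
Local Open Scope ereal_scope.

(* Without this, [edist] is the extended distance of MathComp-Analysis. *)
Local Notation edist := Defs.edist.

(** * Euclidean norm and distance on R^d *)

Section euclidean_distance.
Local Open Scope ring_scope.
Context (R : realType) (d : nat).
Implicit Types x y z : d.-tuple R.

(** With A and B the two norms, the sum of the squares of B a_i - A b_i is nonnegative; expanding it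
    and dividing by 2 A B gives the bound. If A or B is 0, every product a_i b_i vanishes. *)
Lemma cauchy_schwarz_sum n (a b : 'I_n -> R) :
  \sum_i a i * b i <= Num.sqrt (\sum_i a i ^+ 2) * Num.sqrt (\sum_i b i ^+ 2).
Proof.
set A := Num.sqrt (\sum_i a i ^+ 2); set B := Num.sqrt (\sum_i b i ^+ 2).
have A0 : 0 <= A by exact: sqrtr_ge0.
have B0 : 0 <= B by exact: sqrtr_ge0.
have sA : A ^+ 2 = \sum_i a i ^+ 2 by rewrite sqr_sqrtr// sumr_ge0// => i _; exact: sqr_ge0.
have sB : B ^+ 2 = \sum_i b i ^+ 2 by rewrite sqr_sqrtr// sumr_ge0// => i _; exact: sqr_ge0.
have null (c : 'I_n -> R) : \sum_i c i ^+ 2 = 0 -> forall i, c i = 0.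
  move=> /eqP; rewrite psumr_eq0; last by move=> i _; exact: sqr_ge0.
  by move=> /allP h i; apply/eqP; rewrite -sqrf_eq0 (eqP (h i (mem_index_enum i))).
have [A00|A00] := eqVneq A 0.
  rewrite A00 mul0r big1// => i _.
  by rewrite (null a) ?mul0r// -sA A00 expr0n.
have [B00|B00] := eqVneq B 0.
  rewrite B00 mulr0 big1// => i _.
  by rewrite (null b) ?mulr0// -sB B00 expr0n.
have AB : 0 < A * B by rewrite mulr_gt0// lt_neqAle eq_sym ?A00 ?B00.
have : 0 <= \sum_i (B * a i - A * b i) ^+ 2 by rewrite sumr_ge0// => i _; exact: sqr_ge0.
have -> : \sum_i (B * a i - A * b i) ^+ 2 =
    \sum_i (B ^+ 2 * a i ^+ 2 + A ^+ 2 * b i ^+ 2 - (A * B * 2) * (a i * b i)).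
  by apply: eq_bigr => i _; ring.
rewrite big_split/= sumrN big_split/= -!mulr_sumr -sA -sB => h.
rewrite -(ler_pM2l AB); nra.
Qed.

Lemma minkowski_sum n (a b : 'I_n -> R) :
  Num.sqrt (\sum_i (a i + b i) ^+ 2) <=
  Num.sqrt (\sum_i a i ^+ 2) + Num.sqrt (\sum_i b i ^+ 2).
Proof.
have ss (c : 'I_n -> R) : 0 <= \sum_i c i ^+ 2.
  by rewrite sumr_ge0// => i _; exact: sqr_ge0.
have s0 := addr_ge0 (sqrtr_ge0 (\sum_i a i ^+ 2)) (sqrtr_ge0 (\sum_i b i ^+ 2)).
rewrite -(ger0_norm s0) -sqrtr_sqr ler_wsqrtr// sqrrD !sqr_sqrtr//.
under eq_bigr do rewrite sqrrD.
rewrite !big_split/=.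
have := cauchy_schwarz_sum a b; lra.
Qed.

Lemma edist_triangle y x z : edist x z <= edist x y + edist y z.
Proof.
rewrite /edist; under eq_bigr => i _ do rewrite -(subrK (tnth y i) (tnth x i)) -addrA.
exact: minkowski_sum.
Qed.

Lemma edistC x y : edist x y = edist y x.
Proof. by rewrite /edist; under eq_bigr do rewrite -sqrrN opprB. Qed.

Lemma edist_ge0 x y : 0 <= edist x y.
Proof. exact: sqrtr_ge0. Qed.

Lemma enorm_ge0 x : 0 <= enorm x.
Proof. exact: sqrtr_ge0. Qed.

Lemma edist_nseq0 x : edist [tuple of nseq d 0] x = enorm x.
Proof.
by rewrite /edist /enorm; under eq_bigr do rewrite tnth_nseq sub0r sqrrN.
Qed.

Lemma enorm_le_enormN (N : nat) (x : N.-tuple (d.-tuple R)) (i : 'I_N) :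
  enorm (tnth x i) <= enormN x.
Proof.
rewrite -(ger0_norm (enorm_ge0 _)) -sqrtr_sqr ler_wsqrtr//.
by rewrite (bigD1 i)//= lerDl sumr_ge0// => j _; exact: sqr_ge0.
Qed.

Lemma edist_le_coord x y (e : R) : 0 <= e ->
  (forall i, `|tnth x i - tnth y i| <= e) -> edist x y <= d%:R * e.
Proof.
move=> e0 h.
have de : 0 <= d%:R * e by rewrite mulr_ge0.
rewrite -(ger0_norm de) -sqrtr_sqr ler_wsqrtr//.
apply: (@le_trans _ _ (\sum_(i < d) e ^+ 2)).
  by apply: ler_sum => i _; rewrite -real_normK ?num_real// lerXn2r ?nnegrE.
(* The crude factor d, in place of the square root of d, is enough: d e^2 <= (d e)^2 because d <=
   d^2. *)
rewrite sumr_const card_ord -[leLHS]mulr_natl exprMn ler_wpM2r ?sqr_ge0// -natrX ler_nat.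
by case: (d) => // k; rewrite expnS leq_pmulr.
Qed.

Lemma measurable_sqrtr : measurable_fun [set: R] (@Num.sqrt R).
Proof. by apply: continuous_measurable_fun => x; exact: sqrt_continuous. Qed.

Lemma measurable_edist :
  measurable_fun [set: d.-tuple R * d.-tuple R] (fun u => edist u.1 u.2).
Proof.
apply: (measurableT_comp measurable_sqrtr).
apply: measurable_sum => i; apply: measurable_funX; apply: measurable_funB.
- exact: (measurableT_comp (measurable_tnth i) measurable_fst).
- exact: (measurableT_comp (measurable_tnth i) measurable_snd).
Qed.

Lemma measurable_enorm : measurable_fun [set: d.-tuple R] (@enorm R d).
Proof.
apply: (measurableT_comp measurable_sqrtr).
by apply: measurable_sum => i; apply: measurable_funX; exact: measurable_tnth.
Qed.

Lemma measurable_enormN (N : nat) :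
  measurable_fun [set: N.-tuple (d.-tuple R)] (@enormN R d N).
Proof.
apply: (measurableT_comp measurable_sqrtr).
apply: measurable_sum => i; apply: measurable_funX.
exact: (measurableT_comp measurable_enorm (measurable_tnth i)).
Qed.

End euclidean_distance.

(** * Countable partitions into small measurable cells *)

Section countable_cells.
Context (R : realType).

Lemma measurable_preimage_countable d1 (T : measurableType d1) (I : countType)
    (g : T -> I) : (forall i, measurable (g @^-1` [set i])) ->
  forall Y : set I, measurable (g @^-1` Y).
Proof.
move=> mg Y.
have -> : g @^-1` Y = \bigcup_i (g @^-1` [set i] `&` [set _ | Y i]).
  by apply/seteqP; split=> [x Yx|x [i _ [/= <-]]//]; exists (g x).
apply: countable_bigcupT_measurable => [|i]; first exact: countableP.
have [Yi|nYi] := pselect (Y i).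
  by rewrite (_ : [set _ | Y i] = setT) ?setIT//; apply/seteqP; split.
rewrite (_ : [set _ | Y i] = set0) ?setI0//.
by apply/seteqP; split.
Qed.

Lemma measurable_preimage_tuple d1 (T : measurableType d1) (I : countType) n
    (g : 'I_n -> T -> I) : (forall i (Y : set I), measurable (g i @^-1` Y)) ->
  forall Y : set (n.-tuple I), measurable ((fun x => [tuple g i x | i < n]) @^-1` Y).
Proof.
move=> mg; apply: measurable_preimage_countable => t.
rewrite (_ : _ @^-1` _ = \bigcap_(i in [set: 'I_n]) (g i @^-1` [set tnth t i])).
  by apply: fin_bigcap_measurable => [|i _]; [exact: finite_finset | exact: mg].
apply/seteqP; split=> [x /= <- i _|x h] /=; first by rewrite tnth_mktuple.
by apply: eq_from_tnth => i; rewrite tnth_mktuple; exact: h.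
Qed.

(** The cells are the half-open cubes of a grid of side [c], with d c <= e. The vector of integer
    coordinates of a cube is encoded as one natural number by [pickle]. *)
Lemma countable_small_cells d (e : R) : (0 < e)%R ->
  exists q : d.-tuple R -> nat, (forall Y : set nat, measurable (q @^-1` Y)) /\
    forall x y, q x = q y -> (edist x y <= e)%R.
Proof.
move=> e0.
have [c c0 ce] : exists2 c : R, (0 < c)%R & (d%:R * c <= e)%R.
  (* Dividing by d + 1 instead of d also covers d = 0. *)
  exists (e / d.+1%:R)%R; first by rewrite divr_gt0.
  by rewrite mulrA ler_pdivrMr// mulrC ler_pM2l// ler_nat.
pose f (x : d.-tuple R) (i : 'I_d) : int := Num.floor (tnth x i / c).
exists (fun x => pickle [tuple f x i | i < d]); split=> [Y|x y].
  apply: (@measurable_preimage_tuple _ _ _ _ (fun i x => f x i) _ (pickle @^-1` Y)) => i.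
  apply: measurable_preimage_countable => k.
  rewrite (_ : _ @^-1` _ =
      (fun x : d.-tuple R => tnth x i / c)%R @^-1` `[k%:~R, (k + 1)%:~R[); last first.
    apply/seteqP; split=> x /=; rewrite in_itv/=.
      by move=> <-; exact: floor_itv.
    exact: floor_def.
  rewrite -[X in measurable X]setTI.
  by apply: measurable_funM => //; exact: measurable_tnth.
move=> /(pcan_inj pickleK) xy.
apply: (le_trans _ ce); apply: edist_le_coord => [|i]; first exact: ltW.
have fxy : f x i = f y i by have := congr1 (fun t => tnth t i) xy; rewrite !tnth_mktuple.
have /andP[x1 x2] := floor_itv (tnth x i / c)%R.
have /andP[y1 y2] := floor_itv (tnth y i / c)%R.
move: x1 x2 y1 y2; rewrite -/(f x i) -/(f y i) fxy intrD.
rewrite !ler_pdivlMr// !ltr_pdivrMr// => x1 x2 y1 y2.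
by rewrite ler_norml; apply/andP; split; nra.
Qed.

(** Meant for [W1], an infimum over a possibly uncountable set of couplings. The infimum of [F] over
    the n-th cell of w, plus 1/(n+1), depends on the cell only and is therefore measurable. It lies
    between F w and F w + 1/(n+1), so [F] is the infimum of these functions over n. *)
Lemma measurable_fun_countable_approx d1 (T : measurableType d1)
    (F : T -> \bar R) :
  (forall e : R, (0 < e)%R -> exists2 q : T -> nat,
    (forall Y : set nat, measurable (q @^-1` Y)) &
    forall w w', q w = q w' -> F w <= F w' + e%:E) ->
  measurable_fun setT F.
Proof.
move=> h.
have /choice[q qP] : forall n, exists q : T -> nat,
    (forall Y : set nat, measurable (q @^-1` Y)) /\
    forall w w', q w = q w' -> F w <= F w' + (n.+1%:R^-1)%:E.
  by move=> n; have [|q ? ?] := h n.+1%:R^-1%R; [rewrite invr_gt0 | exists q].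
pose v n k := ereal_inf [set F w | w in q n @^-1` [set k]].
pose G n w := v n (q n w) + (n.+1%:R^-1)%:E.
rewrite (_ : F = fun w => einfs (G ^~ w) 0%N).
  apply: measurable_fun_einfs => n; apply: emeasurable_funD => //.
  move=> _ Y mY; rewrite setTI (_ : _ @^-1` _ = q n @^-1` (v n @^-1` Y))//.
  exact: (qP n).1.
apply/funext => w; apply/eqP; rewrite eq_le; apply/andP; split.
  apply/ereal_infP => _ [n /= _ <-]; rewrite /G -leeBlDr//.
  apply/ereal_infP => _ [w' qw <-]; rewrite leeBlDr//.
  by apply: (qP n).2.
apply/lee_addgt0Pr => e e0.
have [n _ /= ne] : \forall n \near \oo, (n.+1%:R^-1 < e :> R)%R.
  exact: near_infty_natSinv_lt (PosNum e0).
apply: (@le_trans _ _ (G n w)); first by apply: ereal_inf_lbound; exists n.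
apply: leeD; first by apply: ereal_inf_lbound; exists w.
by rewrite lee_fin ltW// ne/=.
Qed.

End countable_cells.

(** * Change of variables, for laws known on measurable sets only *)

Section integral_lemmas.
Context d1 d2 (T1 : measurableType d1) (T2 : measurableType d2) (R : realType).

Lemma ge0_integral_image (mu : {measure set T1 -> \bar R})
    (nu : {measure set T2 -> \bar R}) (f : T1 -> T2) (g : T2 -> \bar R) :
  measurable_fun setT f -> measurable_fun setT g -> (forall y, 0 <= g y) ->
  (forall A, measurable A -> mu (f @^-1` A) = nu A) ->
  \int[mu]_x g (f x) = \int[nu]_y g y.
Proof.
move=> mf mg g0 munu.
transitivity (\int[pushforward mu f]_y g y).
  by rewrite ge0_integral_pushforward//.
by apply: eq_measure_integral => A mA _; exact: munu.
Qed.

End integral_lemmas.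

(** * Gluing two couplings along a countable partition of the middle space *)

Section gluing.
Context dX dY dZ (X : measurableType dX) (Y : measurableType dY)
  (Z : measurableType dZ) (R : realType).
Context (pi1 : probability (X * Y)%type R) (pi2 : probability (Y * Z)%type R).
Context (q : Y -> nat) (mq : forall B : set nat, measurable (q @^-1` B)).
Context (same_marginal : forall B, measurable B ->
  pi1 ([set: X] `*` B) = pi2 (B `*` [set: Z])).

Let Q k := q @^-1` [set k].

Let XQ k := [set: X] `*` Q k.
Let QZ k := Q k `*` [set: Z].

Let mQ k : measurable (Q k). Proof. exact: mq. Qed.
Let mXQ k : measurable (XQ k). Proof. exact: measurableX. Qed.
Let mQZ k : measurable (QZ k). Proof. exact: measurableX. Qed.

Let mG k : measurable (XQ k `*` QZ k). Proof. exact: measurableX. Qed.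

(** On a null cell this is 0, as the inverse of 0 is 0, so such a cell contributes nothing. *)
Let c k := (fine (pi2 (QZ k)))^-1%R.

Let c_ge0 k : (0 <= c k)%R.
Proof. by rewrite invr_ge0 fine_ge0. Qed.

(** The product of the two couplings restricted to both middle points lying in cell k, divided by
    the mass of that cell. Summed over k, this is conditional independence given the cell. *)
Let piece k := mscale (NngNum (c_ge0 k)) (mrestr (pi1 \x pi2) (mG k)).

Let glued := mseries (fun k => piece k) 0.

Let glued_prod A B : measurable A -> measurable B ->
  glued (A `*` B) = \sum_(0 <= k <oo)
    ((c k)%:E * (pi1 (A `&` XQ k) * pi2 (B `&` QZ k))).
Proof.
move=> mA mB; apply: eq_eseriesr => k _.
have mAX : measurable (A `&` XQ k) by exact: measurableI.
have mBZ : measurable (B `&` QZ k) by exact: measurableI.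
rewrite -(product_measure1E pi1 pi2 mAX mBZ); congr (_ * (pi1 \x pi2) _).
by apply/seteqP; split=> u [[? ?] [? ?]].
Qed.

Let cellsum d (T : measurableType d) (mu : probability T R) (g : T -> Y) A :
  measurable A -> (forall k, measurable (g @^-1` Q k)) ->
  \sum_(0 <= k <oo) mu (A `&` g @^-1` Q k) = mu A.
Proof.
move=> mA mg.
rewrite -[in RHS](setIT A) (_ : setT = \bigcup_k (g @^-1` Q k)); last first.
  by apply/seteqP; split=> // t _; exists (q (g t)).
rewrite setI_bigcupr measure_bigcup//.
- by apply: eq_eseriesl => k; rewrite in_setT.
- by move=> k _; exact: measurableI.
- by move=> i j _ _ [t [[_ /= ti] [_ /= tj]]]; rewrite -ti -tj.
Qed.

(** Normalisation cancels the mass of the cell; on a null cell the upper bound forces r = 0. *)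
Let cK k (r : \bar R) : 0 <= r <= pi2 (QZ k) ->
  (c k)%:E * (r * pi2 (QZ k)) = r.
Proof.
move=> /andP[r0 rle].
have fin2 : pi2 (QZ k) \is a fin_num by exact: fin_num_measure.
have [z|nz] := eqVneq (pi2 (QZ k)) 0.
  have -> : r = 0 by apply/eqP; rewrite eq_le r0 -z rle.
  by rewrite mul0e mule0.
rewrite muleC -muleA -[pi2 (QZ k)]fineK// -EFinM /c mulfV ?mule1//.
by rewrite -(fineK fin2) eqe in nz.
Qed.

Let glued_fst A : measurable A -> glued (fst @^-1` A) = pi1 A.
Proof.
move=> mA; rewrite -setXT glued_prod//.
rewrite -(@cellsum _ _ pi1 snd A)//; last first.
  by move=> k; rewrite -[X in measurable X]setTI; apply: measurable_snd => //.
apply: eq_eseriesr => k _; rewrite setTI.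
have -> : XQ k = snd @^-1` Q k by rewrite /XQ setTX.
apply: cK; rewrite measure_ge0/= -same_marginal// /XQ setTX.
have mS : measurable (snd @^-1` Q k : set (X * Y)) by rewrite -setTX; exact: mXQ.
by apply: le_measure; rewrite ?inE//; exact: measurableI.
Qed.

Let glued_snd B : measurable B -> glued (snd @^-1` B) = pi2 B.
Proof.
move=> mB; rewrite -setTX glued_prod//.
rewrite -(@cellsum _ _ pi2 fst B)//; last first.
  by move=> k; rewrite -[X in measurable X]setTI; apply: measurable_fst => //.
(* The factor to cancel is now the mass of the cell under [pi1]; the common middle marginal turns it
   into the mass under [pi2], by which the pieces are normalised. *)
apply: eq_eseriesr => k _; rewrite setTI same_marginal// -/(QZ k) [X in _ * X]muleC.
have -> : fst @^-1` Q k = QZ k by rewrite /QZ setXT.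
apply: cK; rewrite measure_ge0/=.
by apply: le_measure; rewrite ?inE//; exact: measurableI.
Qed.

Let gluedT : glued setT = 1.
Proof. by rewrite -(preimage_setT fst) glued_fst// probability_setT. Qed.

(** Each piece is carried by a block where both middle points belong to the same cell. *)
Let glued_diag : glued [set u | q u.1.2 != q u.2.1] = 0.
Proof.
rewrite /glued /mseries eseries0// => k _ _.
transitivity ((c k)%:E * (pi1 \x pi2) set0); last by rewrite measure0 mule0.
congr (_ * (pi1 \x pi2) _).
by apply/seteqP; split=> // u [/= /eqP n [[_ q1] [q2 _]]]; apply: n; rewrite q1 q2.
Qed.

HB.instance Definition _ := Measure.on glued.
HB.instance Definition _ := Measure_isProbability.Build _ _ _ glued gluedT.

(** The two copies of the middle point need not coincide: sharing a cell almost surely is enough, as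
    cells can be taken with arbitrarily small diameter. *)
Lemma gluing : exists pi : probability ((X * Y) * (Y * Z))%type R,
  [/\ forall A, measurable A -> pi (fst @^-1` A) = pi1 A,
      forall B, measurable B -> pi (snd @^-1` B) = pi2 B &
      pi [set u | q u.1.2 != q u.2.1] = 0].
Proof. by exists glued; split. Qed.

End gluing.

(** * Integrals and images of empirical measures *)

Section empirical_integral.
Context d1 (T : measurableType d1) (R : realType) (N : nat).

Lemma ge0_integral_empirical (x : N.+1.-tuple T) (f : T -> \bar R) :
  measurable_fun setT f -> (forall t, 0 <= f t) ->
  \int[empirical R x]_t f t = (N.+1%:R^-1)%:E * \sum_(i < N.+1) f (tnth x i).
Proof.
move=> mf f0.
have N0 : (0 <= N.+1%:R^-1 :> R)%R by rewrite invr_ge0.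
pose del (k : nat) : {measure set T -> \bar R} := \d_(tnth x (inord k)).
transitivity (\int[mscale (NngNum N0) (msum del N.+1)]_t f t).
  apply: eq_measure_integral => A mA _.
  congr (_ * _); apply: eq_bigr => i _.
  by rewrite /del/= inord_val.
rewrite ge0_integral_mscale//; congr (_ * _).
rewrite ge0_integral_measure_sum//; apply: eq_bigr => i _.
by rewrite integral_dirac// diracT mul1e inord_val.
Qed.

Lemma empirical_preimage d2 (S : measurableType d2) (f : S -> T)
    (x : N.+1.-tuple S) (y : N.+1.-tuple T) (A : set T) :
  (forall i, f (tnth x i) = tnth y i) ->
  empirical R x (f @^-1` A) = empirical R y A.
Proof.
move=> fxy; congr (_ * _); apply: eq_bigr => i _.
by rewrite -fxy !diracE; congr (_%:R%:E); apply/idP/idP; rewrite !inE.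
Qed.

End empirical_integral.

(** * The Wasserstein distance: triangle inequality and finiteness *)

Section wasserstein_distance.
Context (R : realType) (d : nat).
Local Notation Rd := (d.-tuple R).
Implicit Types mu nu : probability Rd R.

Lemma W1_ge0 mu nu : 0 <= W1 mu nu.
Proof.
apply/ereal_infP => _ [pi _ <-].
by apply: integral_ge0 => z _; rewrite lee_fin edist_ge0.
Qed.

(** The joint law of f and g is a coupling. Upper bounds on [W1] can thus be proved by exhibiting
    two maps on one probability space. *)
Lemma W1_le_integral d1 (T : measurableType d1) (P : probability T R)
    (f g : T -> Rd) mu nu :
  measurable_fun setT f -> measurable_fun setT g ->
  (forall A, measurable A -> P (f @^-1` A) = mu A) ->
  (forall A, measurable A -> P (g @^-1` A) = nu A) ->
  W1 mu nu <= \int[P]_t (edist (f t) (g t))%:E.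
Proof.
move=> mf mg fmu gnu.
have mfg : measurable_fun setT (fun t => (f t, g t)) by exact/measurable_fun_pair.
pose fg : {mfun T >-> (Rd * Rd)%type} := HB.pack (fun t => (f t, g t))
  (isMeasurableFun.Build _ _ _ _ _ mfg).
rewrite (@ge0_integral_image _ _ _ _ _ P (distribution P fg) (fun t => (f t, g t))
    (fun z : Rd * Rd => (edist z.1 z.2)%:E))//; last 2 first.
- by apply/measurable_EFinP; exact: measurable_edist.
- by move=> z; rewrite lee_fin edist_ge0.
apply: ereal_inf_lbound; exists (distribution P fg) => // A mA.
split; [rewrite -fmu//|rewrite -gnu//]; congr (P _);
  by apply/seteqP; split=> t //= [].
Qed.

Lemma W1_sym mu nu : W1 mu nu = W1 nu mu.
Proof.
suff le : forall a b : probability Rd R, W1 a b <= W1 b a.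
  by apply/eqP; rewrite eq_le !le.
move=> a b; apply/ereal_infP => _ [pi piab <-].
apply: (le_trans (@W1_le_integral _ _ pi snd fst a b _ _ _ _)) => //.
- by move=> A /piab[_ <-]; rewrite setTX.
- by move=> A /piab[<- _]; rewrite setXT.
- by under eq_integral do rewrite edistC.
Qed.

Lemma W1_adherent mu nu (e : R) : (0 < e)%R -> W1 mu nu != +oo ->
  exists2 pi, couplings mu nu pi &
    \int[pi]_z (edist z.1 z.2)%:E <= W1 mu nu + e%:E.
Proof.
move=> e0 Woo.
have [|_ [pi ? <-] /ltW ?] := @lb_ereal_inf_adherent R
  [set \int[pi]_z (edist z.1 z.2)%:E | pi in couplings mu nu] e e0.
  by rewrite -/(W1 mu nu) ge0_fin_numE ?W1_ge0// ltey.
by exists pi.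
Qed.

(** Under the glued measure, the path from the first to the last point runs through both copies of
    the middle point. The outer steps have the costs of the two couplings, and the step between the
    copies costs at most e. *)
Lemma W1_le_couplings a b c (pi1 pi2 : probability (Rd * Rd)%type R) (e : R) :
  (0 < e)%R -> couplings a b pi1 -> couplings b c pi2 ->
  W1 a c <= \int[pi1]_z (edist z.1 z.2)%:E + e%:E +
            \int[pi2]_z (edist z.1 z.2)%:E.
Proof.
move=> e0 h1 h2; have [q [mq qe]] := @countable_small_cells R d e e0.
have [|pi [pif pis pi0]] := @gluing _ _ _ _ _ _ R pi1 pi2 q mq.
  by move=> B mB; rewrite (h1 _ mB).2 (h2 _ mB).1.
have mE : measurable_fun setT (fun z : Rd * Rd => (edist z.1 z.2)%:E).
  by apply/measurable_EFinP; exact: measurable_edist.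
have m11 : measurable_fun setT (fun u : (Rd * Rd) * (Rd * Rd) => u.1.1).
  exact: (measurableT_comp measurable_fst measurable_fst).
have m12 : measurable_fun setT (fun u : (Rd * Rd) * (Rd * Rd) => u.1.2).
  exact: (measurableT_comp measurable_snd measurable_fst).
have m21 : measurable_fun setT (fun u : (Rd * Rd) * (Rd * Rd) => u.2.1).
  exact: (measurableT_comp measurable_fst measurable_snd).
have m22 : measurable_fun setT (fun u : (Rd * Rd) * (Rd * Rd) => u.2.2).
  exact: (measurableT_comp measurable_snd measurable_snd).
have md (f g : (Rd * Rd) * (Rd * Rd) -> Rd) : measurable_fun setT f ->
    measurable_fun setT g -> measurable_fun setT (fun u => (edist (f u) (g u))%:E).
  move=> mf mg.
  exact: (measurableT_comp mE (measurable_fun_pair mf mg)).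
apply: (le_trans (@W1_le_integral _ _ pi (fun u => u.1.1) (fun u => u.2.2) a c _ _ _ _)) => //.
- move=> A mA; rewrite -(h1 _ mA).1 -pif; last exact: measurableX.
  by congr (pi _); apply/seteqP; split=> [u|u []].
- move=> A mA; rewrite -(h2 _ mA).2 -pis; last exact: measurableX.
  by congr (pi _); apply/seteqP; split=> [u|u []].
pose D1 (u : (Rd * Rd) * (Rd * Rd)) := (edist u.1.1 u.1.2)%:E.
pose D0 (u : (Rd * Rd) * (Rd * Rd)) := (edist u.1.2 u.2.1)%:E.
pose D2 (u : (Rd * Rd) * (Rd * Rd)) := (edist u.2.1 u.2.2)%:E.
have mD1 : measurable_fun setT D1 by exact: md.
have mD0 : measurable_fun setT D0 by exact: md.
have mD2 : measurable_fun setT D2 by exact: md.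
have mD10 : measurable_fun setT (fun u => D1 u + D0 u) := emeasurable_funD mD1 mD0.
have Dge0 x y : 0 <= (edist x y : R)%:E by rewrite lee_fin edist_ge0.
apply: (@le_trans _ _ (\int[pi]_u (D1 u + D0 u + D2 u))).
  apply: ge0_le_integral => //; [exact: md|exact: (emeasurable_funD mD10 mD2)|].
  move=> u _; rewrite -!EFinD lee_fin.
  apply: (le_trans (edist_triangle u.2.1 _ _)); rewrite lerD2r.
  exact: edist_triangle.
rewrite ge0_integralD//; last 2 first.
- by move=> u _; rewrite adde_ge0//; exact: Dge0.
- by move=> u _; exact: Dge0.
rewrite ge0_integralD//; [|by move=> u _; exact: Dge0..].
apply: leeD; first apply: leeD.
- by rewrite -(@ge0_integral_image _ _ _ _ _ pi pi1 fst (fun z => (edist z.1 z.2)%:E)).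
(* The two copies lie in one cell, hence within e, off the null set where their cells differ. That
   set is measurable as a countable union over the cell of the first copy. *)
- apply: (@le_trans _ _ (\int[pi]_u (cst e%:E u))); last first.
    by rewrite integral_cst// [X in _ * X](_ : _ = 1) ?mule1//; exact: probability_setT.
  apply: ae_ge0_le_integral => //.
  - by move=> u _; exact: Dge0.
  - by move=> u _; rewrite lee_fin ltW.
  exists [set u | q u.1.2 != q u.2.1]; split=> //.
    rewrite -[X in measurable X]setTI.
    rewrite (_ : setT `&` _ = \bigcup_n
        ((fun u : (Rd * Rd) * (Rd * Rd) => u.1.2) @^-1` (q @^-1` [set n]) `&`
         (fun u => u.2.1) @^-1` (q @^-1` [set k | k != n]))).
      apply: bigcup_measurable => n _; apply: measurableI;
        rewrite -[X in measurable X]setTI.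
        exact: m12.
      exact: m21.
    apply/seteqP; split=> [u [_ /=]|u [n _ [/= <-]]]; last by rewrite eq_sym.
    by exists (q u.1.2) => //; split => //=; rewrite eq_sym.
  move=> u /= hu; apply/negP => /eqP /qe le; apply: hu => _.
  by rewrite lee_fin.
- by rewrite -(@ge0_integral_image _ _ _ _ _ pi pi2 snd (fun z => (edist z.1 z.2)%:E)).
Qed.

Lemma W1_triangle (b a c : probability Rd R) : W1 a c <= W1 a b + W1 b c.
Proof.
have [->|ab] := eqVneq (W1 a b) +oo.
  by rewrite addye ?leey// gt_eqF// (lt_le_trans _ (W1_ge0 _ _)).
have [->|bc] := eqVneq (W1 b c) +oo.
  by rewrite addey ?leey// gt_eqF// (lt_le_trans _ (W1_ge0 _ _)).
(* One third of e goes to each near-optimal coupling and one third to the diameter of the cells. *)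
apply/lee_addgt0Pr => e e0; have e3 : (0 < e / 3)%R by rewrite divr_gt0.
have [pi1 h1 l1] := W1_adherent e3 ab.
have [pi2 h2 l2] := W1_adherent e3 bc.
apply: (le_trans (W1_le_couplings e3 h1 h2)).
apply: (@le_trans _ _ (W1 a b + (e/3)%:E + (e/3)%:E + (W1 b c + (e/3)%:E))).
  by apply: leeD => //; apply: leeD.
have fab : W1 a b \is a fin_num by rewrite ge0_fin_numE ?W1_ge0// ltey.
have fbc : W1 b c \is a fin_num by rewrite ge0_fin_numE ?W1_ge0// ltey.
rewrite -(fineK fab) -(fineK fbc) -!EFinD lee_fin; lra.
Qed.

(** The i-th points are matched with each other: the empirical measure of the pairs is the
    coupling. *)
Lemma W1_empirical_le (N : nat) (x y : N.+1.-tuple Rd) (e : R) :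
  (forall i, edist (tnth x i) (tnth y i) <= e)%R ->
  W1 (empirical R x) (empirical R y) <= e%:E.
Proof.
move=> xye; pose z := [tuple (tnth x i, tnth y i) | i < N.+1].
apply: (le_trans (@W1_le_integral _ _ (empirical R z) fst snd _ _ _ _ _ _)) => //.
- by move=> A mA; apply: empirical_preimage => i; rewrite tnth_mktuple.
- by move=> A mA; apply: empirical_preimage => i; rewrite tnth_mktuple.
rewrite ge0_integral_empirical; last 2 first.
- by apply/measurable_EFinP; exact: measurable_edist.
- by move=> u; rewrite lee_fin edist_ge0.
rewrite sumEFin -EFinM lee_fin ler_pdivrMl//.
apply: (@le_trans _ _ (\sum_(i < N.+1) e)%R).
  by apply: ler_sum => i _; rewrite tnth_mktuple; exact: xye.
by rewrite sumr_const card_ord mulr_natl.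
Qed.

(** The Dirac mass at the origin is the reference point through which first moments give finite
    distances. *)
Lemma W1_dirac0_le mu :
  W1 (\d_[tuple of nseq d (0 : R)%R] : probability Rd R) mu <= \int[mu]_x (enorm x)%:E.
Proof.
apply: (le_trans (@W1_le_integral _ _ mu (cst [tuple of nseq d 0%R]) id _ _ _ _ _ _)) => //.
- move=> A mA; rewrite preimage_cst [RHS]diracE.
  by case: ifPn => _; rewrite ?measure0// probability_setT.
- by under eq_integral do rewrite edist_nseq0.
Qed.

Lemma W1_lty mu nu : P1 mu -> P1 nu -> W1 mu nu < +oo.
Proof.
move=> hm hn; pose d0 : probability Rd R := \d_[tuple of nseq d (0 : R)%R].
apply: (le_lt_trans (W1_triangle d0 _ _)).
by rewrite W1_sym lte_add_pinfty// (le_lt_trans (W1_dirac0_le _)).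
Qed.

Lemma empirical_enorm_le (N : nat) (x : N.+1.-tuple Rd) :
  \int[empirical R x]_y (enorm y)%:E <= (enormN x)%:E.
Proof.
rewrite ge0_integral_empirical; last 2 first.
- by apply/measurable_EFinP; exact: measurable_enorm.
- by move=> u; rewrite lee_fin enorm_ge0.
rewrite sumEFin -EFinM lee_fin ler_pdivrMl//.
apply: (@le_trans _ _ (\sum_(i < N.+1) enormN x)%R).
  by apply: ler_sum => i _; exact: enorm_le_enormN.
by rewrite sumr_const card_ord mulr_natl.
Qed.

End wasserstein_distance.

(** * Measurability of the distance to an empirical measure *)

Section wasserstein_measurable.
Context (R : realType) (d : nat) dW (W : measurableType dW) (N : nat).
Local Notation Rd := (d.-tuple R).

(** Each particle is discretised by the small cells, and the tuple of cell indices is encoded as one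
    natural number. *)
Let cells (X : W -> N.+1.-tuple Rd) (e : R) : measurable_fun setT X -> (0 < e)%R ->
  exists q : W -> nat, (forall Y : set nat, measurable (q @^-1` Y)) /\
    forall w w', q w = q w' -> W1 (empirical R (X w)) (empirical R (X w')) <= e%:E.
Proof.
move=> mX e0; have [q [mq qe]] := @countable_small_cells R d e e0.
exists (fun w => pickle [tuple q (tnth (X w) i) | i < N.+1]); split=> [Y|w w'].
  apply: (@measurable_preimage_tuple _ _ _ _ (fun i w => q (tnth (X w) i)) _ (pickle @^-1` Y)).
  move=> i B; rewrite -[X in measurable X]setTI.
  exact: (measurableT_comp (measurable_tnth i) mX measurableT (mq B)).
move=> /(pcan_inj pickleK) ww'; apply: W1_empirical_le => i; apply: qe.
by have := congr1 (fun t => tnth t i) ww'; rewrite !tnth_mktuple.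
Qed.

Lemma measurable_W1_empirical (X : W -> N.+1.-tuple Rd) (nu : probability Rd R) :
  measurable_fun setT X ->
  measurable_fun setT (fun w => W1 (empirical R (X w)) nu).
Proof.
move=> mX; apply: (@measurable_fun_countable_approx R) => e e0.
have [q [mq qe]] := cells mX e0; exists q => // w w' ww'.
by rewrite addeC (le_trans (W1_triangle (empirical R (X w')) _ _))// leeD2r// qe.
Qed.

Lemma measurable_W1_empirical2 (X Y : W -> N.+1.-tuple Rd) :
  measurable_fun setT X -> measurable_fun setT Y ->
  measurable_fun setT (fun w => W1 (empirical R (X w)) (empirical R (Y w))).
Proof.
move=> mX mY; apply: (@measurable_fun_countable_approx R) => e e0.
have e2 : (0 < e / 2)%R by rewrite divr_gt0.
have [q [mq qe]] := cells mX e2; have [r [mr re]] := cells mY e2.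
exists (fun w => pickle (q w, r w)) => [B|w w' /(pcan_inj pickleK)[ww ww']].
  apply: (@measurable_preimage_countable _ W _ (fun w => (q w, r w)) _ (pickle @^-1` B)).
  move=> [i j]; rewrite (_ : _ @^-1` _ = q @^-1` [set i] `&` r @^-1` [set j]).
    exact: measurableI.
  by apply/seteqP; split=> [u [<- <-]|u [/= -> ->]].
rewrite (le_trans (W1_triangle (empirical R (X w')) _ _))//.
rewrite (splitr e) EFinD [leLHS]addeC addeA; apply: leeD; last exact: qe.
rewrite (le_trans (W1_triangle (empirical R (Y w')) _ _))// leeD2l//.
by rewrite W1_sym re.
Qed.

End wasserstein_measurable.

(** * Geometric bounds and the choice of the balancing time *)

Section real_estimates.
Context (R : realType).

(* For [alpha < 0] the bounds at [n = 0] and [n = 1] force [C * A = 0]. *)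
Lemma geometric_bound (alpha C : R) (A : \bar R) (a : nat -> \bar R) :
  0 <= A -> (forall n, 0 <= a n) ->
  (forall n, a n <= (C * alpha ^+ n)%:E * A) ->
  forall n, a n <= (`|C| * (Num.max alpha 2^-1) ^+ n)%:E * A.
Proof.
move=> A0 a0 aA n; apply: (le_trans (aA n)).
have [->|Ane0] := eqVneq A 0; first by rewrite !mule0.
have Agt0 : 0 < A by rewrite lt_neqAle eq_sym Ane0.
rewrite lee_wpmul2r// lee_fin.
have [alpha0|alpha0] := leP 0%R alpha.
  apply: (@le_trans _ _ (`|C| * alpha ^+ n)%R).
    by rewrite ler_wpM2r ?exprn_ge0// ler_norm.
  rewrite ler_wpM2l// lerXn2r ?nnegrE ?le_max ?lexx//.
  by rewrite alpha0.
have C0 : (0 <= C)%R.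
  by have := le_trans (a0 0%N) (aA 0%N); rewrite expr0 mulr1 pmule_lge0.
have C0' : (0 <= C * alpha)%R.
  by have := le_trans (a0 1%N) (aA 1%N); rewrite expr1 pmule_lge0.
have -> : C = 0%R by apply/eqP; rewrite eq_le C0 andbT -(nmulr_lge0 _ alpha0).
by rewrite normr0 !mul0r.
Qed.

(* The time m ~ theta ln(N+1) balances tau^m (N+1)^(-1/d) against beta^m. *)
Lemma balancing_time (d : nat) (tau beta : R) :
  (0 < d)%N -> (1 < tau)%R -> (0 < beta < 1)%R ->
  exists kappa : R, [/\ (0 < kappa)%R, (kappa < d%:R^-1)%R &
    forall N : nat, exists m : nat,
      (N.+1%:R `^ (- d%:R^-1) * tau ^+ m <= (N.+1%:R `^ kappa)^-1)%R /\
      (beta ^+ m <= beta^-1 * (N.+1%:R `^ kappa)^-1)%R].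
Proof.
move=> d0 tau1 /andP[beta0 beta1].
have lt0 : (0 < ln tau)%R by rewrite ln_gt0.
have lb0 : (ln beta < 0)%R by rewrite ln_lt0// beta0.
have tau0 : (0 < tau)%R by rewrite (lt_trans _ tau1).
set D : R := d%:R^-1%R; have D0 : (0 < D)%R by rewrite invr_gt0 ltr0n.
(* With m <= theta ln(N+1), the growth of tau^m uses up at most half of the exponent D = 1/d. *)
set theta : R := (D / 2 / ln tau)%R.
have theta0 : (0 < theta)%R by rewrite !divr_gt0.
have thetaE : (theta * ln tau = D / 2)%R by rewrite /theta divfK// gt_eqF.
(* The smaller of the exponent D/2 left over after the growth of tau^m and the exponent at which
   beta^m decays. In particular it is below 1/d. *)
pose kappa : R := (Num.min (D / 2) (theta * - ln beta))%R.
have k1 : (kappa <= D / 2)%R by rewrite ge_min lexx.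
have k2 : (kappa <= theta * - ln beta)%R by rewrite ge_min lexx orbT.
exists kappa; split.
- by rewrite lt_min divr_gt0//= mulr_gt0// oppr_gt0.
- by apply: (le_lt_trans k1); lra.
move=> N; set l : R := ln N.+1%:R.
have l0 : (0 <= l)%R by rewrite ln_ge0// ler1n.
have powE x : (N.+1%:R `^ x = expR (x * l))%R by rewrite /powR pnatr_eq0.
have tl0 : (0 <= theta * l)%R by rewrite mulr_ge0// ltW.
(* Rounding down loses less than one unit of time, whence the factor beta^-1 in the second
   estimate. *)
have /andP[m1 m2] := truncn_itv tl0.
set m := Num.truncn (theta * l)%R in m1 m2 *.
have expE (x : R) : (0 < x)%R -> (x ^+ m = expR (m%:R * ln x))%R.
  by move=> x0; rewrite expRM_natl lnK.
exists m; rewrite !powE expE// expE// -expRN -{2}(lnK beta0) -expRN -!expRD !ler_expR.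
rewrite -natr1 in m2.
by split; nra.
Qed.

Lemma geometric_small (c beta : R) : (0 < beta < 1)%R -> (0 <= c)%R ->
  exists m, (c * beta ^+ m <= 2^-1)%R.
Proof.
move=> /andP[beta0 beta1] c0.
have b : (`|beta| < 1)%R by rewrite gtr0_norm.
have := cvg_geometric c b.
move=> /cvgrPdist_le /(_ 2^-1%R); case=> [|m _ /(_ m)/=]; first by rewrite invr_gt0.
rewrite leqnn sub0r normrN => /(_ isT) h; exists m.
by rewrite (le_trans _ h)// ler_norm.
Qed.

End real_estimates.

(** * First moment of the initial law *)

Section particle_system.
Context (R : realType) (d : nat).
Local Notation Rd := (d.-tuple R).

Lemma ge0_integral_le_add d1 (T : measurableType d1) (P : probability T R)
    (f g h : T -> \bar R) :
  measurable_fun setT f -> measurable_fun setT g -> measurable_fun setT h ->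
  (forall t, 0 <= f t) -> (forall t, 0 <= g t) -> (forall t, 0 <= h t) ->
  (forall t, f t <= g t + h t) ->
  \int[P]_t f t <= \int[P]_t g t + \int[P]_t h t.
Proof.
move=> mf mg mh f0 g0 h0 fgh; rewrite -ge0_integralD//.
by apply: ge0_le_integral => //; exact: emeasurable_funD.
Qed.

Lemma integral_cst_probability d1 (T : measurableType d1) (P : probability T R)
    (a : \bar R) : \int[P]_t (cst a t) = a.
Proof.
by rewrite integral_cst// [X in _ * X](_ : _ = 1) ?mule1//; exact: probability_setT.
Qed.

(** The first particle has law [eta], and r <= 1 + r^p for r >= 0 and p > 1. *)
Lemma P1_first_particle d1 (T : measurableType d1) (P : probability T R) (p : R)
    (N : nat) (X : {RV P >-> N.+1.-tuple Rd}) (eta : probability Rd R) (M : R) :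
  (1 < p)%R -> is_power eta (distribution P X) ->
  \int[P]_w ((enorm (tnth (X w) ord0)) `^ p)%:E <= M%:E -> P1 eta.
Proof.
move=> p1 Xeta hM.
have m0 : measurable_fun setT (fun w => tnth (X w) ord0).
  exact: (measurableT_comp (measurable_tnth ord0) (measurable_funPT X)).
rewrite /P1 -(@ge0_integral_image _ _ _ _ _ P eta (fun w => tnth (X w) ord0)
    (fun x : Rd => (enorm x)%:E))//; last 3 first.
- by apply/measurable_EFinP; exact: measurable_enorm.
- by move=> x; rewrite lee_fin enorm_ge0.
(* The marginal is read off the box that constrains only the first coordinate. *)
- move=> A mA; pose B (i : 'I_N.+1) := if i == ord0 then A else setT.
  transitivity (\prod_(i < N.+1) eta (B i)); last first.
    rewrite (bigD1 ord0)//= big1 ?mule1// => i /negbTE i0.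
    by rewrite /B i0 probability_setT.
  rewrite -Xeta => [|i]; last by rewrite /B; case: ifP.
  congr (P _); apply/seteqP; split=> w /=.
    by move=> Aw i; rewrite /B; case: ifPn => // /eqP ->.
  by move=> /(_ ord0).
have mE : measurable_fun setT (fun w => (enorm (tnth (X w) ord0))).
  exact: (measurableT_comp (@measurable_enorm R d) m0).
apply: (@le_lt_trans _ _ (1 + M%:E)); last by rewrite -EFinD ltry.
rewrite -[X in _ <= X + _](integral_cst_probability P).
apply: le_trans (leeD2l _ hM); apply: ge0_integral_le_add => //.
- exact/measurable_EFinP.
- by apply/measurable_EFinP; exact: (measurableT_comp (measurable_powR p) mE).
- by move=> w; rewrite lee_fin enorm_ge0.
- by move=> w; rewrite lee_fin powR_ge0.
move=> w; rewrite /cst -EFinD lee_fin; set e := enorm _.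
have e0 : (0 <= e)%R by exact: enorm_ge0.
have [e1|/ltW e1] := leP e 1%R; first by rewrite ler_wpDr// powR_ge0.
rewrite ler_wpDl// -[leLHS]powRr1//.
by rewrite ler_powR// ltW.
Qed.

End particle_system.

(** * Estimates for a fixed number of particles *)

Section one_particle_system.
Context (R : realType) (d : nat).
Local Notation Rd := (d.-tuple R).
Context dW (W : measurableType dW) (P : probability W R) (N : nat)
  (X Xinf : nat -> {RV P >-> N.+1.-tuple Rd})
  (etaN : probability (N.+1.-tuple Rd) R) (eta : nat -> probability Rd R).
Context (Xinf_law : forall n, distribution P (Xinf n) ≡μ etaN).

Let E n := \int[P]_w W1 (empirical R (X n w)) (eta n).
Let T n := \int[P]_w W1 (empirical R (X n w)) (empirical R (Xinf n w)).
Let D n := \int[etaN]_y W1 (empirical R y) (eta n).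

Let T_ge0 n : 0 <= T n.
Proof. by apply: integral_ge0 => w _; exact: W1_ge0. Qed.

Let measurable_E nu (Y : {RV P >-> N.+1.-tuple Rd}) :
  measurable_fun setT (fun w => W1 (empirical R (Y w)) nu).
Proof. by apply: measurable_W1_empirical; exact: measurable_funPT. Qed.

Let measurable_T (Y Z : {RV P >-> N.+1.-tuple Rd}) :
  measurable_fun setT (fun w => W1 (empirical R (Y w)) (empirical R (Z w))).
Proof. by apply: measurable_W1_empirical2; exact: measurable_funPT. Qed.

Let measurable_D nu :
  measurable_fun setT (fun y : N.+1.-tuple Rd => W1 (empirical R y) nu).
Proof. by apply: measurable_W1_empirical; exact: measurable_id. Qed.

(* The joint law of [X k] and [Xinf k] varies with [k]; the law of [Xinf k]
   does not. *)
Let integral_Xinf k n : \int[P]_w W1 (empirical R (Xinf k w)) (eta n) = D n.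
Proof.
rewrite (@ge0_integral_image _ _ _ _ _ P etaN (Xinf k)
  (fun y => W1 (empirical R y) (eta n)))//.
- by move=> y; exact: W1_ge0.
- by move=> A mA; exact: Xinf_law.
Qed.

Let E_le_T_D n : E n <= T n + D n.
Proof.
rewrite -(integral_Xinf n n); apply: ge0_integral_le_add => // w;
  by [exact: W1_ge0|exact: W1_triangle].
Qed.

Let D_le_T_E n : D n <= T n + E n.
Proof.
rewrite -(integral_Xinf n n); apply: ge0_integral_le_add => // w; try exact: W1_ge0.
by rewrite [X in _ <= X + _]W1_sym; exact: W1_triangle.
Qed.

(** Time enters [D] only through [eta], because the law [etaN] is the same at all times. This is
    what connects time n with time m. *)
Let D_shift m n : D n <= D m + W1 (eta m) (eta n).
Proof.
rewrite -[X in _ <= _ + X](integral_cst_probability etaN).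
apply: ge0_integral_le_add => // y; by [exact: W1_ge0|exact: W1_triangle].
Qed.

Lemma late_time_bound m n :
  E n <= T n + (T m + E m) + W1 (eta m) (eta n).
Proof.
rewrite -addeA; apply: (le_trans (E_le_T_D n)); apply: leeD => //.
by apply: (le_trans (D_shift m n)); apply: leeD.
Qed.

Context (etaN_P1 : P1N etaN) (eta0_P1 : P1 (eta 0)).

(** Both measures are compared with the Dirac mass at the origin. The resulting bound may depend on
    N and serves only to make T 0 finite. *)
Let D0_lty : D 0 < +oo.
Proof.
pose d0 : probability Rd R := \d_[tuple of nseq d (0 : R)%R].
apply: (@le_lt_trans _ _ (\int[etaN]_y (enormN y)%:E + W1 d0 (eta 0))); last first.
  by apply: lte_add_pinfty => //; apply: (le_lt_trans (W1_dirac0_le _)).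
rewrite -[X in _ <= _ + X](integral_cst_probability etaN).
apply: ge0_integral_le_add => //.
- by apply/measurable_EFinP; exact: measurable_enormN.
- by move=> y; exact: W1_ge0.
- by move=> y; rewrite lee_fin sqrtr_ge0.
- by move=> y; exact: W1_ge0.
move=> y; apply: (le_trans (W1_triangle d0 _ _)); rewrite leeD2r// W1_sym.
exact: (le_trans (W1_dirac0_le _) (empirical_enorm_le y)).
Qed.

Lemma initial_gap_bound (C tau c beta w : R) (m : nat) :
  (forall n, E n <= (C * tau ^+ n)%:E) ->
  T m <= (c * beta ^+ m)%:E * T 0 -> (c * beta ^+ m <= 2^-1)%R ->
  W1 (eta m) (eta 0) <= w%:E ->
  T 0 <= (2 * (C + C * tau ^+ m + w))%:E.
Proof.
move=> hE hT hc hw.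
have TE : T 0 <= E 0 + D 0.
  rewrite -(integral_Xinf 0 0); apply: ge0_integral_le_add => // u; try exact: W1_ge0.
  by rewrite [X in _ <= _ + X]W1_sym; exact: W1_triangle.
have E0 : E 0 <= C%:E by have := hE 0%N; rewrite expr0 mulr1.
have T0fin : T 0 \is a fin_num.
  rewrite ge0_fin_numE// (le_lt_trans TE)// lte_add_pinfty//.
  by rewrite (le_lt_trans E0)// ltry.
have hTm : T m <= (2^-1)%:E * T 0.
  by apply: (le_trans hT); rewrite lee_wpmul2r// lee_fin.
(* From E 0 + D 0, pass to D m and then to T m + E m; half of T 0 is then absorbed on the left,
   which is legitimate as T 0 is finite. *)
have : T 0 <= C%:E + ((2^-1)%:E * T 0 + (C * tau ^+ m)%:E + w%:E).
  apply: (le_trans TE); apply: leeD => //.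
  apply: (le_trans (D_shift m 0)); apply: leeD => //.
  by apply: (le_trans (D_le_T_E m)); apply: leeD.
rewrite -(fineK T0fin) -EFinM -!EFinD !lee_fin; lra.
Qed.

End one_particle_system.

(** * The bound uniform in time *)

Theorem theorem3p2 (R : realType) (d : nat) (hd : (3 <= d)%N)
    (K : probability (d.-tuple R) R -> R.-pker (d.-tuple R) ~> (d.-tuple R))
    (hK : kernel_family K) (hKs : standing_assumption K)
    (p : R) (hp : (1 < p)%R) (hpd : p <> (d%:R / (d%:R - 1))%R)
    (eta0 eta_inf : probability (d.-tuple R) R)
    (d0 : nat -> measure_display) (W : forall N, measurableType (d0 N))
    (P : forall N, probability (W N) R)
    (X : forall N, nat -> {RV (P N) >-> N.+1.-tuple (d.-tuple R)})
    (hX : forall N, particle_dynamics K (X N))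
    (hX0 : forall N, is_power eta0 (distribution (P N) (X N 0%N)))
    (h1 : E1 K eta0 X p) (h2 : E2 K eta0 eta_inf X) (h3 : E3 eta_inf) :
  exists kappa C' : R,
    (0 < kappa)%R /\ (kappa < d%:R^-1)%R /\
    forall n N : nat,
      \int[P N]_w W1 (empirical R (X N n w)) (mean_field K eta0 n)
        <= (C' / N.+1%:R `^ kappa)%:E.
Proof.
have [tau [_ tau1 [M [Mstar hM]] [C C0 hE]]] := h1.
have [alpha [C2 [alpha1 [hinf _] hmf hN]]] := h2.
have tau0 : (0 <= tau)%R by rewrite ltW// (lt_trans _ tau1).
(* The moment bound for the system with a single particle, at time 0, suffices. *)
have eta0P1 : P1 eta0.
  exact: (@P1_first_particle _ _ _ _ _ p 0 (X 0%N 0%N) eta0 (M 0%N) hp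
    (hX0 0%N) (hM 0%N 0%N).1).
set eta := mean_field K eta0.
(* The maximum with 1/2 makes the rate positive, so that its logarithm and inverse can be used, and
   keeps it below 1. *)
pose beta : R := (Num.max alpha 2^-1)%R; pose c : R := `|C2|%R.
have beta01 : (0 < beta < 1)%R.
  by rewrite lt_max gt_max alpha1 invr_gt0 ltr0n orbT/= invf_lt1// ltr1n.
have /andP[beta0 beta1] := beta01.
have c0 : (0 <= c)%R by exact: normr_ge0.
have Winf := W1_lty eta0P1 hinf.
pose w0 := fine (W1 eta0 eta_inf).
have w0E : W1 eta0 eta_inf = w0%:E by rewrite fineK// ge0_fin_numE// W1_ge0.
have w00 : (0 <= w0)%R by rewrite fine_ge0// W1_ge0.
have hw n : W1 (eta n) eta_inf <= (c * beta ^+ n * w0)%:E.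
  rewrite EFinM -w0E.
  by apply: (@geometric_bound _ alpha C2 _ (fun n => W1 (eta n) eta_inf)) => //;
    [exact: W1_ge0|move=> ?; exact: W1_ge0].
(* Both measures are within c beta^m w0 of [eta_inf], since beta^n <= beta^m. *)
have hw2 m n : (m <= n)%N -> W1 (eta m) (eta n) <= (2 * (c * beta ^+ m * w0))%:E.
  move=> mn; apply: (le_trans (W1_triangle eta_inf _ _)).
  rewrite [X in _ + X]W1_sym mulr_natl mulr2n EFinD; apply: leeD => //.
  apply: (le_trans (hw n)); rewrite lee_fin ler_wpM2r// ler_wpM2l//.
  by rewrite ler_wiXn2l// ltW.
(* Discarding this factor makes the bound on the initial gap uniform in N. *)
have L1 N : (N.+1%:R `^ (- d%:R^-1) <= 1 :> R)%R.
  by rewrite -[leRHS](@powRr0 R N.+1%:R) ler_powR// ?ler1n.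
have [m0 hm0] := geometric_small beta01 c0.
(* The bound on the initial gap at the fixed time [m0], where 2 c w0 bounds the distance from
   [eta m0] to [eta 0]. *)
pose S := (2 * (C + C * tau ^+ m0 + 2 * (c * w0)))%R.
have S0 : (0 <= S)%R.
  by rewrite mulr_ge0// !addr_ge0// ?mulr_ge0// ?exprn_ge0// ltW.
have d_gt0 : (0 < d)%N by exact: leq_trans hd.
have [kappa [k0 kd hk]] := balancing_time d_gt0 tau1 beta01.
(* C comes from E_m. The gaps T_n and T_m contribute c S beta^m each, the distance from eta_m to
   eta_n contributes 2 c w0 beta^m, and beta^m <= beta^-1 (N+1)^-kappa. *)
exists kappa, (C + (2 * c * (S + w0)) * beta^-1)%R; split=> //; split=> // n N.
have [etaN [etaNP1 _ [Xinf [Xlaw hT]]]] := hN N.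
pose T k := \int[P N]_w W1 (empirical R (X N k w)) (empirical R (Xinf k w)).
have T0_ge0 : 0 <= T 0%N by apply: integral_ge0 => w _; exact: W1_ge0.
have hTn k : T k <= (c * beta ^+ k)%:E * T 0%N.
  apply: (@geometric_bound _ alpha C2 _ T) => // j.
  by apply: integral_ge0 => w _; exact: W1_ge0.
have hTS : T 0%N <= S%:E.
  apply: (@initial_gap_bound _ _ _ _ (P N) N (X N) Xinf etaN eta Xlaw etaNP1 eta0P1
    C tau c beta (2 * (c * w0))%R m0) => //.
    move=> k; apply: (le_trans (hE N k)).
    by rewrite lee_fin mulrAC ler_piMr// mulr_ge0 ?exprn_ge0// ltW.
    exact: hTn.
  rewrite W1_sym; apply: (le_trans (hw2 0%N m0 isT)).
  by rewrite expr0 mulr1.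
have hTk k : T k <= (c * beta ^+ k * S)%:E.
  apply: (le_trans (hTn k)); rewrite [leRHS]EFinM lee_wpmul2l// lee_fin.
  by rewrite mulr_ge0// exprn_ge0// ltW.
have [m [m1 m2]] := hk N.
set x := (N.+1%:R `^ kappa)%R in m1 m2 *.
have hEm : (C * N.+1%:R `^ (- d%:R^-1) * tau ^+ m <= C * x^-1)%R.
  by rewrite -mulrA ler_wpM2l// ltW.
have x0 : (0 <= x^-1)%R by rewrite invr_ge0 powR_ge0.
(* Up to the balancing time, tau^n <= tau^m; after it, beta^n <= beta^m. *)
have [nm|mn] := leqP n m.
  apply: (le_trans (hE N n)); rewrite lee_fin.
  apply: (@le_trans _ _ (C * N.+1%:R `^ (- d%:R^-1) * tau ^+ m)%R).
    rewrite ler_wpM2l ?ler_weXn2l ?ltW// mulr_gt0// powR_gt0//.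
  apply: (le_trans hEm); rewrite ler_wpM2r// lerDl.
  apply: mulr_ge0; last by rewrite invr_ge0 ltW.
  by rewrite !mulr_ge0// addr_ge0.
apply: (le_trans (@late_time_bound _ _ _ _ (P N) N (X N) Xinf etaN eta Xlaw m n)).
have hTn' : T n <= (c * beta ^+ m * S)%:E.
  apply: (le_trans (hTk n)); rewrite lee_fin ler_wpM2r// ler_wpM2l//.
  by apply: ler_wiXn2l; [exact: ltW|exact: ltW|exact: ltnW].
apply: (@le_trans _ _ ((c * beta ^+ m * S)%:E + ((c * beta ^+ m * S)%:E +
    (C * x^-1)%:E) + (2 * (c * beta ^+ m * w0))%:E)).
  apply: leeD; last exact: hw2 (ltnW mn).
  apply: leeD => //; apply: leeD; first exact: hTk.
  by apply: (le_trans (hE N m)); rewrite lee_fin.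
rewrite -!EFinD lee_fin.
have : (2 * c * (S + w0) * beta ^+ m <= 2 * c * (S + w0) * (beta^-1 * x^-1))%R.
  by rewrite ler_wpM2l// !mulr_ge0// addr_ge0.
lra.
Qed.
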